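(* Let $h^{\rm c}:[1,2]\to[1,\infty]$ and $h:[1,3]\to[1,\infty]$ be nonincreasing functions with $h(\kappa)\ge h^{\rm c}(\kappa)$ for all $\kappa\in[1,2]$ and $h^{\rm c}(2)=h(3)=1$. Then there exists a metric measure space $\mathfrak Z$ such that for each $\kappa\in[1,2)$ the operator $\mathcal M^{\rm c}_{\kappa,\mathfrak Z}$ is of weak type $(p,p)$ if and only if $p>h^{\rm c}(\kappa)$ or $p=\infty$, and for each $\kappa\in[1,3)$ the operator $\mathcal M_{\kappa,\mathfrak Z}$ is of weak type $(p,p)$ if and only if $p>h(\kappa)$ or $p=\infty$.
   Context: Metric measure space $(X,\rho,\mu)$: nonempty set, metric, nonnegative Borel measure, every open ball $B(x,s)$ having finite strictly positive measure. For $\kappa\ge1$: $\mathcal M^{\rm c}_{\kappa}f(x)=\sup_{s>0}\mu(B(x,\kappa s))^{-1}\int_{B(x,s)}|f|d\mu$ and $\mathcal M_\kappa f(x)=\sup\{\mu(B(y,\kappa s))^{-1}\int_{B(y,s)}|f|d\mu: y\in X, s>0, x\in B(y,s)\}$. Weak type $(p,p)$ for $p\in[1,\infty)$: $\lambda\mu(\{|Tf|>\lambda\})^{1/p}\lesssim\|f\|_p$ uniformly in $f\in L^p$, $\lambda>0$; weak type $(\infty,\infty)$ means boundedness on $L^\infty$. *)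

(* Defs.v *)
From HB Require Import structures.
From mathcomp Require Import all_boot all_order all_algebra.
From mathcomp Require Import all_classical all_reals all_analysis.
Set Implicit Arguments. Unset Strict Implicit. Unset Printing Implicit Defensive.
Import Order.TTheory GRing.Theory Num.Theory.
Local Open Scope classical_set_scope.
Local Open Scope ring_scope.

Section MMS.
Context {d : measure_display} {X : measurableType d} {R : realType}.

Definition mball (rho : X -> X -> R) (x : X) (s : R) : set X :=
  [set y | rho x y < s].

Definition is_metric (rho : X -> X -> R) : Prop :=
  (forall x y, 0 <= rho x y) /\
  (forall x y, rho x y = 0 <-> x = y) /\
  (forall x y, rho x y = rho y x) /\
  (forall x y z, rho x z <= rho x y + rho y z).

Definition rho_open (rho : X -> X -> R) : set (set X) :=
  [set A | forall x, A x -> exists2 r : R, 0 < r & mball rho x r `<=` A].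

Definition is_mms (rho : X -> X -> R) (mu : {measure set X -> \bar R}) : Prop :=
  [/\ (exists x : X, True),
      is_metric rho,
      (@measurable d X) = <<s rho_open rho >> &
      (forall x s, 0 < s -> (0 < mu (mball rho x s))%E /\ (mu (mball rho x s) < +oo)%E)].

Definition ball_avg (rho : X -> X -> R) (mu : {measure set X -> \bar R})
  (kappa : R) (f : X -> R) (y : X) (s : R) : \bar R :=
  ((\int[mu]_(z in mball rho y s) (`|f z|)%:E) * ((fine (mu (mball rho y (kappa * s))))^-1)%:E)%E.

Definition Mc (rho : X -> X -> R) (mu : {measure set X -> \bar R})
  (kappa : R) (f : X -> R) (x : X) : \bar R :=
  ereal_sup [set ball_avg rho mu kappa f x s | s in [set s : R | 0 < s]].

Definition Mu (rho : X -> X -> R) (mu : {measure set X -> \bar R})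
  (kappa : R) (f : X -> R) (x : X) : \bar R :=
  ereal_sup [set ball_avg rho mu kappa f ys.1 ys.2 |
               ys in [set ys : X * R | 0 < ys.2 /\ rho ys.1 x < ys.2]].

(* outer measure induced by mu (used for level sets, whose measurability
   is not assumed) *)
Definition outer_mu (mu : {measure set X -> \bar R}) (A : set X) : \bar R :=
  ereal_inf [set mu B | B in [set B | measurable B /\ A `<=` B]].

Definition weak_type (mu : {measure set X -> \bar R})
  (T : (X -> R) -> X -> \bar R) (p : \bar R) : Prop :=
  match p with
  | EFin r => exists C : R, forall f : X -> R,
      measurable_fun setT f ->
      (Lnorm mu r%:E (fun x => (f x)%:E) < +oo)%E ->
      forall lam : R, 0 < lam ->
        (lam%:E * (outer_mu mu [set x | (lam%:E < T f x)%E]) `^ (r^-1)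
           <= C%:E * Lnorm mu r%:E (fun x => (f x)%:E))%E
  | +oo%E => exists C : R, forall f : X -> R,
      measurable_fun setT f ->
      (Lnorm mu +oo%E (fun x => (f x)%:E) < +oo)%E ->
      (Lnorm mu +oo%E (T f) <= C%:E * Lnorm mu +oo%E (fun x => (f x)%:E))%E
  | -oo%E => False
  end.

End MMS.

(* Main.v *)
Require Import Defs.
From HB Require Import structures.
From mathcomp Require Import all_boot all_order all_algebra.
From mathcomp Require Import all_classical all_reals all_analysis.
From mathcomp Require Import ess_sup_inf ring lra.
Set Implicit Arguments. Unset Strict Implicit. Unset Printing Implicit Defensive.
Import Order.TTheory GRing.Theory Num.Theory.
Local Open Scope classical_set_scope.
Local Open Scope ring_scope.

(** The space is a countable union of bounded blocks at mutual distance 3.  Block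
    number [j] has a center of mass 1, leaves [x_0, x_1, ...], of which the first
    [n] have mass [M] while all other points weigh at most 3 in total, and stems
    [y_i] at distance 1 from both [x_i] and the center (all masses being then
    multiplied by [tau j]).  Testing on the center, a ball reaching one leaf and the
    center gives averages about [1 / M] on a set of mass [n * M] as long as the
    dilated ball does not reach the other leaves, so that weak type [(p, p)] amounts
    to boundedness of [n * M ^ (1 - p)] over the blocks where this can happen.  A
    parameter [e] decides that: if the leaves are at distance 1 from the center and
    [e <= 2] from each other, it happens for both operators when [kappa < e]; if
    they are at distance [min 2 e] from the center and from each other, and each
    stem is at distance [e <= 3] from the foreign leaves, only non-centered balls
    are bad, again when [kappa < e].

    It remains to find, for a nonincreasing [g], parameters such that
    [n * M ^ (1 - p)] is bounded over [{j | kappa < e j}] exactly when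
    [g kappa < p].  Take [n * M ^ (1 - p) = 2 ^ (N * (2 + N * (r - p)))], where
    [r = 1 + i / N] runs over the rationals, and let [e] lie slightly to the right of
    [{kappa | r <= g kappa}]. *)

(* [(j, None)] is the center of block [j], [(j, Some (true, i))] its leaf [x_i] and
   [(j, Some (false, i))] its stem [y_i]. *)
Definition pt : Type := (nat * option (bool * nat))%type.

HB.instance Definition _ := Countable.on pt.
HB.instance Definition _ := isPointed.Build pt (0%N, None).
HB.instance Definition _ := @isMeasurable.Build default_measure_display
  pt discrete_measurable discrete_measurable0
  discrete_measurableC discrete_measurableU.

Lemma pt_measurable_fun d' (T : measurableType d') (D : set pt) (f : pt -> T) :
  measurable_fun D f.
Proof. by []. Qed.

(** * The metric *)

Section BlockMetric.
Context {R : realType}.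

(* [t] puts the leaves at distance 1 from the center. *)
Definition bdist (t : bool) (e : R) (a b : option (bool * nat)) : R :=
  let c := Num.min 2 e in
  match a, b with
  | None, None => 0
  | None, Some (l, _) | Some (l, _), None =>
      if l then (if t then 1 else c) else 1
  | Some (l, i), Some (l', i') =>
      if i == i' then (if l == l' then 0 else 1) else (if l == l' then c else e)
  end.

Lemma bdistC t e a b : bdist t e a b = bdist t e b a.
Proof.
case: a => [[l i]|]; case: b => [[l' i']|] //=.
by rewrite (eq_sym i) (eq_sym l).
Qed.

Lemma bdistxx t e a : bdist t e a a = 0.
Proof. by case: a => [[l i]|] //=; rewrite !eqxx. Qed.

Lemma min2_case (e : R) : 1 <= e ->
  [/\ e <= 2 & Num.min 2 e = e] \/ [/\ 2 < e & Num.min 2 e = 2].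
Proof.
by move=> e1; case: (leP e 2) => e2; [left|right]; split=> //.
Qed.

Lemma bdist_ge1 t e a b : 1 <= e -> a != b -> 1 <= bdist t e a b.
Proof.
move=> e1; case: a => [[l i]|]; case: b => [[l' i']|] //=;
  case: (min2_case e1) => -[e2 ->].
- by case: (eqVneq i i') => [->|_]; case: (eqVneq l l') => [->|_]; rewrite ?eqxx.
- by case: (eqVneq i i') => [->|_]; case: (eqVneq l l') => [->|_]; rewrite ?eqxx//; lra.
- by case: l; case: t.
- by case: l; case: t => // _; lra.
- by case: l'; case: t.
- by case: l'; case: t => // _; lra.
Qed.

Lemma bdist_le3 t e a b : 1 <= e <= 3 -> bdist t e a b <= 3.
Proof.
move=> /andP[e1 e3]; case: a => [[l i]|]; case: b => [[l' i']|] //=;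
  case: (min2_case e1) => -[e2 ->];
  repeat case: ifP => _; lra.
Qed.

(** If [e <= 2], all distances are at most 2, and two proper steps already have length 2. If
    [e > 2], only the distance [e <= 3] between a leaf and a foreign stem exceeds 2; a detour has
    length at least 3, since the only point at distance 1 from a leaf is its own stem. *)
Lemma bdist_triangle (t : bool) (e : R) a b c : 1 <= e <= 3 -> (t -> e <= 2) ->
  bdist t e a c <= bdist t e a b + bdist t e b c.
Proof.
move=> /andP[e1 e3] te.
have [->|ab] := eqVneq a b; first by rewrite bdistxx add0r.
have [->|bc] := eqVneq b c; first by rewrite bdistxx addr0.
have D1 := bdist_ge1 t e1 ab; have D2 := bdist_ge1 t e1 bc.
have [e2|e2] := leP e 2.
  suff : bdist t e a c <= 2 by lra.
  case: a ab D1 => [[l i]|] ? ?; case: c bc D2 => [[l' i']|] ? ? //=;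
  case: (min2_case e1) => -[? ->]; repeat case: ifP => _; lra.
have {te} tF : t = false by case: t te {D1 D2} => // /(_ isT); lra.
rewrite {t}tF in D1 D2 *; move: D1 D2.
have {ab bc} consistent i j k : i = j -> j = k -> i != k :> nat -> False.
  by move=> -> -> /eqP.
case: a => [[l i]|]; case: b => [[l' i']|]; case: c => [[l'' i'']|] //=;
  case: (min2_case e1) => -[? ->]; try lra.
- case: (eqVneq i i'') => E0; case: (eqVneq i i') => E1;
  case: (eqVneq i' i'') => E2; try (by have := consistent _ _ _ E1 E2 E0);
  by case: l; case: l'; case: l'' => /=; lra.
- by case: l; case: l' => /=; case: ifP => _; lra.
- by case: l; case: l'' => /=; case: ifP => _; lra.
- by case: l'; case: l'' => /=; case: ifP => _; lra.
Qed.

Variables (t : nat -> bool) (e : nat -> R).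

Definition rho (x y : pt) : R :=
  if x.1 == y.1 then bdist (t x.1) (e x.1) x.2 y.2 else 3.

Hypothesis e13 : forall j, 1 <= e j <= 3.
Hypothesis te2 : forall j, t j -> e j <= 2.

Lemma rho_block j a b : rho (j, a) (j, b) = bdist (t j) (e j) a b.
Proof. by rewrite /rho eqxx. Qed.

Lemma rho_ge1 x y : x != y -> 1 <= rho x y.
Proof.
case: x y => [j a] [k b]; rewrite /rho /=; case: (eqVneq j k) => [<- ab|_ _]; last lra.
case/andP: (e13 j) => e1 _; apply: bdist_ge1 => //.
by apply: contra ab => /eqP ->.
Qed.

Lemma rho_le3 x y : rho x y <= 3.
Proof. by rewrite /rho; case: ifP => _ //; exact: bdist_le3. Qed.

Lemma rhoxx x : rho x x = 0.
Proof. by rewrite /rho eqxx bdistxx. Qed.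

Lemma rho_lt1 x y : rho x y < 1 -> x = y.
Proof. by move=> h; case: (eqVneq x y) => // /rho_ge1; rewrite leNgt h. Qed.

Lemma rho_metric : is_metric rho.
Proof.
split=> [x y|].
  by case: (eqVneq x y) => [->|/rho_ge1]; rewrite ?rhoxx//; lra.
split=> [x y|].
  split=> [h|->]; last exact: rhoxx.
  by apply: rho_lt1; rewrite h.
split=> [x y|x y z].
  by rewrite /rho (eq_sym y.1); case: eqP => // ->; rewrite bdistC.
have [->|xy] := eqVneq x y; first by rewrite rhoxx add0r.
have [->|yz] := eqVneq y z; first by rewrite rhoxx addr0.
have h1 := rho_ge1 xy; have h2 := rho_ge1 yz; have h3 := rho_le3 x z.
rewrite /rho in h1 h2 h3 *.
case: (eqVneq x.1 y.1) h1 => [E1|N1] h1; case: (eqVneq y.1 z.1) h2 => [E2|N2] h2.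
- by rewrite E1 E2 eqxx -E2 -E1; apply: bdist_triangle => //; exact: te2.
- by rewrite E1 (negbTE N2); rewrite E1 in h1; lra.
- by rewrite -E2 (negbTE N1); lra.
- by lra.
Qed.

(** Distinct points are at distance at least 1, so every set is open, and every set is
    measurable. *)
Lemma rho_measurable_open :
  (@measurable _ pt) = <<s rho_open rho >>.
Proof.
apply/seteqP; split=> // A _; apply: sub_sigma_algebra => x Ax.
by exists 1 => // y /rho_lt1 <-.
Qed.

End BlockMetric.

(** * The measure *)

Section AtomicMeasure.
Context {R : realType}.

Lemma le_mu (mu : {measure set pt -> \bar R}) (A B : set pt) :
  A `<=` B -> (mu A <= mu B)%E.
Proof. by move=> AB; apply: le_measure => //; rewrite inE. Qed.

Lemma muU (mu : {measure set pt -> \bar R}) (A B : set pt) :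
  (mu (A `|` B) <= mu A + mu B)%E.
Proof. exact: measureU2. Qed.

(** A series of weighted Dirac masses over the codes of points; [pickle_inv] decodes genuine codes
    only, so no point is counted twice. *)
Lemma atomic_measure (w : pt -> R) : (forall x, 0 <= w x) ->
  exists mu : {measure set pt -> \bar R}, forall x, mu [set x] = (w x)%:E.
Proof.
move=> w0.
pose m k : {measure set pt -> \bar R} :=
  if pickle_inv k is Some x then mscale (NngNum (w0 x)) (dirac x) else mzero.
have mE k A : m k A = if pickle_inv k is Some x then ((w x)%:E * \d_x A)%E else 0%E.
  by rewrite /m; case: (pickle_inv k).
exists (mseries m 0) => x; rewrite /= /mseries ereal_series.
rewrite (nneseriesD1 (n := pickle x))//.
rewrite eseries0 ?adde0; first by rewrite mE pickleK_inv diracE mem_set//= mule1.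
move=> k _ /= kx; rewrite mE.
case E : (pickle_inv k) => [y|//]; rewrite diracE memNset ?mule0// => /= yx.
by have := @pickle_invK pt k; rewrite E /= => ky; rewrite -ky yx eqxx in kx.
Qed.

End AtomicMeasure.

Definition ctr (j : nat) : pt := (j, None).
Definition leaf (j i : nat) : pt := (j, Some (true, i)).
Definition stem (j i : nat) : pt := (j, Some (false, i)).
Definition block (j : nat) : set pt := [set x | x.1 = j].
Definition ray (j i : nat) : set pt := [set leaf j i; stem j i].
Definition heavy (n : nat -> nat) (j : nat) : set pt :=
  [set x | exists2 i, (i < n j)%N & x = leaf j i].
Definition light (n : nat -> nat) (j : nat) : set pt := block j `\` heavy n j.

Section Masses.
Context {R : realType}.
Variables (n : nat -> nat) (M tau : nat -> R).

Definition mass (x : pt) : R :=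
  tau x.1 * (if x.2 is Some (l, i) then
               if l && (i < n x.1)%N then M x.1 else (2 ^ i.+1)%:R^-1
             else 1).

Variable mu : {measure set pt -> \bar R}.
Hypothesis mu1 : forall x, mu [set x] = (mass x)%:E.
Hypothesis tau_gt0 : forall j, 0 < tau j.
Hypothesis M_gt0 : forall j, 0 < M j.

Lemma mass_gt0 x : 0 < mass x.
Proof.
rewrite /mass mulr_gt0//; case: x.2 => [[l i]|//].
by case: ifP => _ //; rewrite invr_gt0 ltr0n expn_gt0.
Qed.

Lemma mu_leaf j i : (i < n j)%N -> mu [set leaf j i] = (tau j * M j)%:E.
Proof. by move=> ij; rewrite mu1 /mass /= ij. Qed.

Lemma mu_ctr j : mu [set ctr j] = (tau j)%:E.
Proof. by rewrite mu1 /mass /= mulr1. Qed.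

(** Up to the factor [tau j], the center contributes 1 and ray [i] at most [2 / 2 ^ i.+1], from its
    stem and from its leaf when that is not heavy. *)
Lemma mu_light j : (mu (light n j) <= (3 * tau j)%:E)%E.
Proof.
pose Q i := ray j i `&` light n j.
have QE i : (mu (Q i) <= (2 * tau j / (2 ^ i.+1)%:R)%:E)%E.
  rewrite -mulrA mulr_natl mulr2n EFinD.
  have h : Q i `<=` (light n j `&` [set leaf j i]) `|` [set stem j i].
    by move=> x [[-> h|->]]; [left|right].
  apply: (le_trans (le_mu _ h)); apply: (le_trans (muU _ _ _)).
  apply: leeD; last by rewrite mu1 /mass /=.
  have [ij|ij] := ltnP i (n j).
    suff -> : light n j `&` [set leaf j i] = set0.
      by rewrite measure0 lee_fin mulr_ge0 ?invr_ge0// ltW.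
    by apply/seteqP; split => // x [[_ hx] xi]; apply: hx; exists i.
  apply: (le_trans (le_mu _ (@subIsetr _ _ _))).
  by rewrite mu1 /mass /= ltnNge ij.
have h : light n j `<=` [set ctr j] `|` \bigcup_i Q i.
  move=> [k [[l i]|]] [kj nh]; move: kj nh; rewrite /block /= => ->; last by left.
  move=> nh; right; exists i => //; split=> //.
  by case: l nh => nh; [left|right].
apply: (le_trans (le_mu _ h)); apply: (le_trans (muU _ _ _)).
rewrite mu_ctr (_ : 3 * tau j = tau j + 2 * tau j); last by ring.
rewrite EFinD leeD2l//.
apply: (le_trans (measure_sigma_subadditive _ _ _ (@subset_refl _ _))) => //.
apply: (le_trans (lee_nneseries _ (fun i _ => QE i))) => //.
by apply: epsilon_trick0; rewrite mulr_ge0// ltW.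
Qed.

Lemma heavyE j : heavy n j = \big[setU/set0]_(i < n j) [set leaf j i].
Proof.
rewrite -(bigcup_mkord (n j) (fun i => [set leaf j i])); apply/seteqP.
by split=> x [i ij ->]; exists i.
Qed.

Lemma mu_heavy j : mu (heavy n j) = ((n j)%:R * (tau j * M j))%:E.
Proof.
rewrite heavyE; transitivity (\sum_(i < n j) mu [set leaf j i])%E.
  apply: (@measure_bigsetU _ _ _ mu (fun i => [set leaf j i])) => //.
  apply/trivIsetP => a b _ _ ab; apply/seteqP; split => // x [/= ->] [] /eqP.
  by rewrite (negbTE ab).
rewrite (eq_bigr (fun=> (tau j * M j)%:E)); last by move=> i _; rewrite mu_leaf.
by rewrite sumEFin sumr_const card_ord mulr_natl.
Qed.

Lemma mu_block j : (mu (block j) <= (tau j * (3 + (n j)%:R * M j))%:E)%E.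
Proof.
have h : block j `<=` light n j `|` heavy n j.
  by move=> x bx; have [hx|nx] := pselect (heavy n j x); [right|left].
apply: (le_trans (le_mu _ h)); apply: (le_trans (muU _ _ _)).
rewrite mu_heavy mulrDr EFinD leeD//; first by rewrite mulrC mu_light.
by rewrite lee_fin mulrCA.
Qed.

(** A ball of radius above 3 is the whole space, so the total mass has to be finite; this choice of
    [tau] makes the masses of the blocks summable. *)
Lemma mu_setT_le1 : (forall j, tau j * (3 + (n j)%:R * M j) = 1 / (2 ^ j.+1)%:R) ->
  (mu setT <= 1)%E.
Proof.
move=> tauE; apply: (@le_trans _ _ (\sum_(j <oo) mu (block j))%E).
  by apply: measure_sigma_subadditive => // x _; exists x.1.
apply: le_trans (@epsilon_trick0 R 1 xpredT ler01).
apply: lee_nneseries => // j _; rewrite -tauE; exact: mu_block.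
Qed.

End Masses.

(** * Balls *)

Section BallGeometry.
Context {R : realType}.
Variables (t : nat -> bool) (e : nat -> R).
Hypothesis e13 : forall j, 1 <= e j <= 3.
Hypothesis te2 : forall j, t j -> e j <= 2.

Local Notation ball z s := (mball (rho t e) z s).

Lemma mball_setT z s : 3 < s -> ball z s = setT.
Proof.
move=> s3; apply/seteqP; split=> // y _.
by rewrite /mball /=; apply: le_lt_trans s3; exact: rho_le3.
Qed.

Lemma mball_center z s : 0 < s -> ball z s z.
Proof. by rewrite /mball /= rhoxx. Qed.

Lemma mball_le z s s' : s <= s' -> ball z s `<=` ball z s'.
Proof. by move=> ss' y; rewrite /mball /= => /lt_le_trans; exact. Qed.

Lemma mball_block z s : s <= 3 -> ball z s `<=` block z.1.
Proof.
move=> s3 y; rewrite /mball /block /= /rho; case: eqP => // _ h.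
by have := lt_le_trans h s3; rewrite ltxx.
Qed.

(** Seen from a leaf or a stem, no point of another ray is closer than the center. The hypothesis
    [ball z s z] excludes that [z] is the center itself. *)
Lemma mball_ray z s : s <= 3 -> ball z s z -> ~ ball z s (ctr z.1) ->
  exists i, ball z s `<=` ray z.1 i.
Proof.
move=> s3; case: z => [j [[l i]|]] //= _ nctr; exists i => -[k a] yB.
have := mball_block s3 yB; rewrite /block /= => kj; rewrite {k}kj in yB *.
move: nctr yB; rewrite /mball /= !rho_block /= => /negP; rewrite -leNgt.
case/andP: (e13 j) => e1 e3.
case: a => [[l' i']|] sl; last by move=> h; have := lt_le_trans h sl; rewrite ltxx.
have [->|ii] := eqVneq i' i; first by case: l'; [left|right].
move: sl.
case: (min2_case e1) => -[e2 ->]; case: l => /=; case: l' => //=;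
  try case: (t j); lra.
Qed.

(** All leaves are equally far from the center of the block. From a leaf or stem [z], all foreign
    leaves have a common distance, at most [e j]. If [kappa * s] exceeds it, the dilated ball
    contains every leaf. Otherwise leaf [i] lies on the ray of [z], and reaching the center forces
    [1 < s], whence [kappa < kappa * s <= e j]; for a leaf [z] it also forces [t j], as without it
    the center is as far as the other leaves. *)
Lemma mball_leaves (kappa : R) j i z s : 1 <= kappa -> s <= 3 ->
  ball z s (ctr j) -> ball z s (leaf j i) ->
  (forall k, ball z (kappa * s) (leaf j k)) \/
  [/\ kappa < e j, z = leaf j i -> t j &
      forall k, k != i -> ~ ball z (kappa * s) (leaf j k)].
Proof.
move=> k1 s3 Bc Bl; have zj := mball_block s3 Bc; rewrite /block /= in zj.
have s0 : 0 < s.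
  apply: le_lt_trans Bc; have [->|zc] := eqVneq z (ctr j); first by rewrite rhoxx.
  exact: (le_trans _ (rho_ge1 t e13 zc)).
have ks : s <= kappa * s by rewrite ler_peMl// ltW.
case: z zj Bc Bl => j' a /= <-; rewrite /mball /= !rho_block.
case/andP: (e13 j) => e1 e3; have te := @te2 j.
case: a => [[l m]|] /=; last first.
  by move=> _ h; left => k; rewrite rho_block /=; apply: lt_le_trans ks.
have [ksle|ksgt] := leP (kappa * s) (if l then Num.min 2 (e j) else e j);
    last first.
  move=> Bc Bl; left => k; rewrite rho_block /=.
  case: (eqVneq m k) => mk; case: l ksgt Bc Bl => //= ksgt Bc Bl.
  - by apply: lt_le_trans ks.
  - by apply: lt_le_trans ks.
case: l ksle => /= ksle Bc Bl.
  have tj : t j.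
    case: (boolP (t j)) Bc => // _ Bc.
    by have := lt_le_trans Bc (le_trans ks ksle); rewrite ltxx.
  rewrite tj in Bc.
  have im : m = i.
    apply/eqP; apply: contraT => mi; rewrite (negbTE mi) in Bl.
    by have := lt_le_trans Bl (le_trans ks ksle); rewrite ltxx.
  rewrite im; right; split => // [|k ki].
    have : Num.min 2 (e j) <= e j by case: (min2_case e1) => -[? ->]; lra.
    move=> h; apply: lt_le_trans (le_trans ksle h).
    by rewrite ltr_pMr//; lra.
  rewrite rho_block /= (eq_sym i) (negbTE ki) => h.
  by have := lt_le_trans h ksle; rewrite ltxx.
have im : m = i.
  apply/eqP; apply: contraT => mi; rewrite (negbTE mi) in Bl.
  by have := lt_le_trans Bl (le_trans ks ksle); rewrite ltxx.
rewrite im; right; split => // [|k ki].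
  by apply: lt_le_trans ksle; rewrite ltr_pMr//; lra.
rewrite rho_block /= (eq_sym i) (negbTE ki) => h.
by have := lt_le_trans h ksle; rewrite ltxx.
Qed.

Lemma mball_leaf_sub n j i : t j -> ball (leaf j i) (e j) `<=` [set leaf j i] `|` light n j.
Proof.
move=> tj x xB; have [h|h] := pselect (heavy n j x); last first.
  by right; split=> //; case/andP: (e13 j) => _ e3; exact: (mball_block e3 xB).
left; case: h xB => k _ ->; rewrite /mball /= rho_block /=.
case: (eqVneq i k) => [->//|_] h; exfalso; move: h; have := te2 tj.
by case/andP: (e13 j) => e1 _; case: (min2_case e1) => -[? ->]; lra.
Qed.

Lemma mball_stem_sub n j i : ball (stem j i) (e j) `<=` [set leaf j i] `|` light n j.
Proof.
move=> x xB; have [h|h] := pselect (heavy n j x); last first.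
  by right; split=> //; case/andP: (e13 j) => _ e3; exact: (mball_block e3 xB).
left; case: h xB => k _ ->; rewrite /mball /= rho_block /=.
by case: (eqVneq i k) => [->//|_]; rewrite ltxx.
Qed.

End BallGeometry.

(** * Weak type estimates *)

(** A pointwise substitute for Hölder's inequality that covers [p = 1] as well: above the level [b],
    the quotient [(y / b) ^ (p - 1)] is at least 1. *)
Lemma le_add_powR {R : realType} (b y p : R) : 0 < b -> 0 <= y -> 1 <= p ->
  y <= b + b `^ (1 - p) * y `^ p.
Proof.
move=> b0 y0 p1; have [yb|yb] := leP y b.
  by rewrite (le_trans yb)// lerDl mulr_ge0// powR_ge0.
have y0' : 0 < y by exact: lt_trans yb.
have /negbTE y0F : y != 0 by rewrite gt_eqF.
rewrite (@le_trans _ _ (b `^ (1 - p) * y `^ p))// ?lerDr ?(ltW b0)//.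
have -> : y `^ p = y `^ (p - 1) * y.
  by rewrite -[X in _ * X]powRr1// -powRD ?subrK// y0F implybT.
rewrite mulrA ler_peMl// -opprB powRN mulrC ler_pdivlMr ?powR_gt0// mul1r.
by apply: ge0_ler_powR; rewrite ?nnegrE ?subr_ge0 ?(ltW b0) ?(ltW y0') ?(ltW yb).
Qed.

Section Integrals.
Context {R : realType}.
Variables (mu : {measure set pt -> \bar R}) (f : pt -> R) (p : R).

(** Masses of bad sets are compared with this countably additive set function, so that estimates on
    disjoint pieces can be added. *)
Definition nu (A : set pt) : \bar R := (\int[mu]_(x in A) ((`|f x| `^ p)%:E))%E.

Lemma nu_ge0 A : (0 <= nu A)%E.
Proof. by apply: integral_ge0 => x _; rewrite lee_fin powR_ge0. Qed.

Lemma le_nu A B : A `<=` B -> (nu A <= nu B)%E.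
Proof.
by move=> AB; apply: ge0_subset_integral => // x _; rewrite lee_fin powR_ge0.
Qed.

Lemma nu_bigcup (F : nat -> set pt) : trivIset setT F ->
  nu (\bigcup_i F i) = (\sum_(i <oo) nu (F i))%E.
Proof.
by move=> tF; apply: ge0_integral_bigcup => // x _; rewrite lee_fin powR_ge0.
Qed.

Lemma le_integral_nu b A : 0 < b -> 1 <= p ->
  (\int[mu]_(x in A) `|f x|%:E <= b%:E * mu A + (b `^ (1 - p))%:E * nu A)%E.
Proof.
move=> b0 p1; rewrite -integral_cst// /nu -ge0_integralZl_EFin ?powR_ge0//.
rewrite -ge0_integralD//; last 2 first.
- by move=> x _; rewrite lee_fin ltW.
- by move=> x _; rewrite -EFinM lee_fin mulr_ge0 ?powR_ge0.
apply: ge0_le_integral => // x _.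
by rewrite -EFinM -EFinD lee_fin le_add_powR.
Qed.

End Integrals.

(** * Mass carried by a single ball with a large average *)

Section BadBall.
Context {R : realType}.
Variables (t : nat -> bool) (e : nat -> R) (mu : {measure set pt -> \bar R}).
Variables (kappa lam p : R) (f : pt -> R) (z : pt) (s : R).
Hypotheses (mu_fin : (mu setT < +oo)%E) (mu_gt0 : forall x, (0 < mu [set x])%E).
Hypotheses (k1 : 1 <= kappa) (p1 : 1 <= p) (lam0 : 0 < lam) (s0 : 0 < s).
Hypothesis nu_fin : (nu mu f p setT < +oo)%E.
Hypothesis bad : (lam%:E < ball_avg (rho t e) mu kappa f z s)%E.

Local Notation B := (mball (rho t e) z s).
Local Notation kB := (mball (rho t e) z (kappa * s)).
Local Notation c := (((lam / 3) `^ p)^-1).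

Lemma mu_fin_num A : mu A \is a fin_num.
Proof. by rewrite ge0_fin_numE// (le_lt_trans _ mu_fin)// le_mu. Qed.

Lemma nu_fin_num A : nu mu f p A \is a fin_num.
Proof. by rewrite ge0_fin_numE ?nu_ge0// (le_lt_trans _ nu_fin)// le_nu. Qed.

Lemma mball_sub_dilate : B `<=` kB.
Proof. by apply: mball_le; rewrite ler_peMl// ltW. Qed.

Lemma bad_ball_lt : (lam%:E * mu kB < \int[mu]_(x in B) `|f x|%:E)%E.
Proof.
(* [ball_avg] divides by a [fine] value, so the denominator is cleared only once the dilated ball is
   known to have positive finite mass. *)
have kB0 : 0 < fine (mu kB).
  apply: fine_gt0; rewrite (lt_le_trans (mu_gt0 z)) /=; last first.
    apply: le_mu => _ ->; apply: mball_sub_dilate; exact: mball_center.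
  by rewrite (le_lt_trans _ mu_fin)// le_mu.
move: bad; rewrite /ball_avg lte_pdivlMr// => h.
by rewrite -[mu kB]fineK// mu_fin_num.
Qed.

(** At the level [lam / 3], the mass term of [le_integral_nu] is at most a third of [lam * mu kB]
    and can be absorbed. *)
Lemma mu_bad_ball : (mu kB <= c%:E * nu mu f p B)%E.
Proof.
have a0 : 0 < lam / 3 by rewrite divr_gt0.
have := lt_le_trans bad_ball_lt (le_integral_nu mu f B a0 p1).
rewrite -(fineK (mu_fin_num kB)) -(fineK (mu_fin_num B)) -(fineK (nu_fin_num B)).
rewrite -!EFinM -EFinD lte_fin lee_fin.
have : fine (mu B) <= fine (mu kB).
  by rewrite fine_le ?mu_fin_num// le_mu//; exact: mball_sub_dilate.
have : 0 <= fine (mu kB) by rewrite fine_ge0.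
have := powR_gt0 p a0.
rewrite powRD ?(gt_eqF a0) ?implybT// powRr1 ?(ltW a0)// powRN.
move: a0; have -> : lam = 3 * (lam / 3) by field.
rewrite mulrAC divff// mul1r.
move: (lam / 3) => a a0.
move: (a `^ p) (fine (mu kB)) (fine (mu B)) (fine (nu mu f p B)) => q m m' v.
move=> q0 m0 mm' h; suff : a * (2 * m) < a * (q^-1 * v) by rewrite ltr_pM2l//; lra.
have : a * m' <= a * m by rewrite ler_pM2l.
by move: h; rewrite -!mulrA; lra.
Qed.

(* The two parts of the ball are compared with the levels [a = lam / 3] and
   [a * M / 3], for which the mass terms add up to at most 2/3 of [lam * tau * M]. *)
Lemma mu_bad_leaf (n : nat -> nat) (M tau : nat -> R) j i :
  (forall x, mu [set x] = (mass n M tau x)%:E) ->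
  (forall j, 0 < tau j) -> (forall j, 0 < M j) ->
  (i < n j)%N -> kB (leaf j i) -> B `<=` [set leaf j i] `|` light n j ->
  (mu [set leaf j i] <=
   c%:E * (nu mu f p [set leaf j i] + ((M j / 3) `^ (1 - p))%:E * nu mu f p (block j)))%E.
Proof.
move=> mu1 tau0 M0 ij kBl Bsub.
have a0 : 0 < lam / 3 by rewrite divr_gt0.
have m0 : 0 < M j / 3 by rewrite divr_gt0.
have am0 : 0 < (lam / 3) * (M j / 3) by rewrite mulr_gt0.
have Isplit : (\int[mu]_(x in B) `|f x|%:E <=
    \int[mu]_(x in [set leaf j i]) `|f x|%:E + \int[mu]_(x in light n j) `|f x|%:E)%E.
  rewrite -ge0_integral_setU//; last first.
    by apply/disj_setPS => x [/= -> [_]]; apply; exists i.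
  exact: ge0_subset_integral.
have h1 := le_integral_nu mu f [set leaf j i] a0 p1.
have h2 := le_integral_nu mu f (light n j) am0 p1.
have h3 := lt_le_trans bad_ball_lt (le_trans Isplit (leeD h1 h2)).
have h4 : (lam%:E * (tau j * M j)%:E <= lam%:E * mu kB)%E.
  rewrite lee_pmul2l ?lte_fin// -(mu_leaf mu1 ij).
  by apply: le_mu => _ ->.
have {h1 h2 h3 h4} := le_lt_trans h4 h3.
have lightle : light n j `<=` block j by exact: subDsetl.
have := le_nu mu f p lightle.
have := mu_light mu1 tau0 j.
rewrite (mu_leaf mu1 ij) -(fineK (mu_fin_num (light n j))).
rewrite -(fineK (nu_fin_num [set leaf j i])) -(fineK (nu_fin_num (light n j))).
rewrite -(fineK (nu_fin_num (block j))).
rewrite -!(EFinM, EFinD) lte_fin !lee_fin.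
have := powR_gt0 p a0; have := powR_gt0 (1 - p) m0.
rewrite (powRM _ (ltW a0) (ltW m0)).
have -> : (lam / 3) `^ (1 - p) = lam / 3 * ((lam / 3) `^ p)^-1.
  by rewrite powRD ?(gt_eqF a0) ?implybT// powRr1 ?(ltW a0)// powRN.
move: a0 m0 am0; have -> : lam = 3 * (lam / 3) by field.
rewrite (mulrAC 3 (lam / 3)) divff// mul1r.
move: (lam / 3) (tau0 j) (M0 j) => a; move: (a `^ p) ((M j / 3) `^ (1 - p)).
move: (tau j) (M j) (fine _) (fine _) (fine _) (fine _) => T m v1 v2 v3 v4 q r.
move=> T0 m0 a0 _ _ r0 q0.
move=> h4 h3 h.
have qi0 : 0 < q^-1 by rewrite invr_gt0.
have l1 : a * (m / 3) * v4 <= a * (T * m).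
  have -> : a * (T * m) = a * (m / 3) * (3 * T) by field.
  by rewrite ler_pM2l// !mulr_gt0.
have l2 : q^-1 * (r * v3) <= q^-1 * (r * v2) by rewrite !ler_pM2l.
have l3 : a * (T * m) < a * (q^-1 * v1 + q^-1 * (r * v3)) by move: h; lra.
by rewrite ltr_pM2l// in l3; rewrite mulrDr; lra.
Qed.

End BadBall.

(** * Sufficiency: level sets estimated block by block *)

Section UpperBound.
Context {R : realType}.
Variables (t : nat -> bool) (e : nat -> R) (n : nat -> nat) (M tau : nat -> R).
Variables (mu : {measure set pt -> \bar R}) (kappa : R).
Hypothesis e13 : forall j, 1 <= e j <= 3.
Hypothesis mu1 : forall x, mu [set x] = (mass n M tau x)%:E.
Hypothesis tau0 : forall j, 0 < tau j.
Hypothesis M0 : forall j, 0 < M j.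
Hypothesis mu_fin : (mu setT < +oo)%E.
Hypothesis k1 : 1 <= kappa.

Local Notation ball z s := (mball (rho t e) z s).

Lemma mu1_gt0 x : (0 < mu [set x])%E.
Proof. by rewrite mu1 lte_fin mass_gt0. Qed.

(** One argument serves both operators: [adm x z s] selects the balls competing at [x], and [on j]
    marks the blocks where a dilated ball may contain the center and just one leaf. *)
Variables (adm : pt -> pt -> R -> Prop) (T : (pt -> R) -> pt -> \bar R).
Variable on : nat -> Prop.
Hypothesis opP : forall f x l, (l < T f x)%E <->
  exists z s, [/\ 0 < s, adm x z s & (l < ball_avg (rho t e) mu kappa f z s)%E].
Hypothesis adm_ball : forall x z s, 0 < s -> adm x z s -> ball z s x.
Hypothesis adm_leaf : forall j i z s, s <= 3 ->
  adm (leaf j i) z s -> ball z s (ctr j) -> ball z s (leaf j i) ->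
  (forall k, ball z (kappa * s) (leaf j k)) \/
  (on j /\ forall k, k != i -> ~ ball z (kappa * s) (leaf j k)).

Section Level.
Variables (p lam C : R) (f : pt -> R).
Hypotheses (p1 : 1 <= p) (lam0 : 0 < lam) (C0 : 0 <= C).
Hypothesis onC : forall j, on j -> (n j)%:R * (M j / 3) `^ (1 - p) <= C.
Hypothesis nu_fin : (nu mu f p setT < +oo)%E.

Local Notation c := (((lam / 3) `^ p)^-1).
Local Notation v := (nu mu f p).

Definition bad_at x z s :=
  [/\ 0 < s, adm x z s & (lam%:E < ball_avg (rho t e) mu kappa f z s)%E].

Let c_gt0 : 0 < c.
Proof. by rewrite invr_gt0 powR_gt0// divr_gt0. Qed.

Let bad_mu x z s : bad_at x z s -> (mu (ball z (kappa * s)) <= c%:E * v (ball z s))%E.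
Proof. by move=> [s0 _ bad]; apply: (mu_bad_ball mu_fin mu1_gt0 k1). Qed.

Let bad_dilate x z s : bad_at x z s -> ball z (kappa * s) x.
Proof.
by move=> [s0 /(adm_ball s0) + _]; apply: mball_sub_dilate.
Qed.

Let c_le A A' : A `<=` A' -> (c%:E * v A <= c%:E * v A')%E.
Proof. by move=> AA'; rewrite lee_pmul2l ?lte_fin//; exact: le_nu. Qed.

(** A ball missing the center stays in one ray. A ray has two points, and each bad one has mass at
    most [c] times the [nu] of the ray; hence the factor 2. *)
Lemma mu_level_offcenter j : (mu [set x | block j x /\ exists z s,
  [/\ bad_at x z s, (s <= 3)%R & ~ ball z s (ctr j)]] <= (2 * c)%:E * v (block j))%E.
Proof.
set E := [set x | _].
have Eray x : E x -> exists2 i, ray j i x & (mu [set x] <= c%:E * v (ray j i))%E.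
  move=> [xj [z [s [bad s3 nc]]]]; have [s0 az _] := bad.
  have xB := adm_ball s0 az.
  have zj : z.1 = j by rewrite -xj (mball_block s3 xB).
  rewrite -zj in nc; have [i Bi] := mball_ray e13 s3 (mball_center t e z s0) nc.
  rewrite zj in Bi; exists i; first exact: Bi.
  apply: le_trans (c_le Bi); apply: le_trans (bad_mu bad).
  by apply: le_mu => _ ->; exact: bad_dilate bad.
have ray_inj i k x : ray j i x -> ray j k x -> i = k.
  by move=> [] -> [] [].
have Ei i : (mu (E `&` ray j i) <= (2 * c)%:E * v (ray j i))%E.
  rewrite mulr_natl mulr2n EFinD ge0_muleDl ?lee_fin ?(ltW c_gt0)//.
  have h : E `&` ray j i `<=` (E `&` [set leaf j i]) `|` (E `&` [set stem j i]).
    by move=> x [Ex [xl|xs]]; [left|right].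
  have pt_le x : ray j i x -> (mu (E `&` [set x]) <= c%:E * v (ray j i))%E.
    move=> rx; have [Ex|nEx] := pselect (E x).
      have [k rk hk] := Eray x Ex; rewrite (ray_inj _ _ _ rx rk).
      by apply: le_trans hk; apply: le_mu; exact: subIsetr.
    rewrite (_ : E `&` [set x] = set0).
      by rewrite measure0 mule_ge0 ?nu_ge0// lee_fin ltW.
    by apply/seteqP; split => // y [Ey yx]; apply: nEx; rewrite -yx.
  apply: (le_trans (le_mu _ h)); apply: (le_trans (muU _ _ _)).
  by apply: leeD; apply: pt_le; [left|right].
have EU : E `<=` \bigcup_i (E `&` ray j i).
  by move=> x Ex; have [i ri _] := Eray x Ex; exists i.
apply: (le_trans (measure_sigma_subadditive _ _ _ EU)) => //.
apply: (le_trans (lee_nneseries _ (fun i _ => Ei i))) => //.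
rewrite nneseriesZl//; last by move=> i _; exact: nu_ge0.
rewrite lee_pmul2l ?lte_fin ?mulr_gt0// -nu_bigcup.
  by apply: le_nu => x [i _ []] ->.
apply/trivIsetP => i k _ _ ik; apply/seteqP; split => // x [ri rk].
by move: ik; rewrite (ray_inj _ _ _ ri rk) eqxx.
Qed.

(** One bad ball through the center suffices: it pays for the mass [tau j] of the center, and the
    light part weighs at most three times as much. *)
Lemma mu_level_light j : (mu [set x | light n j x /\ exists z s,
  [/\ bad_at x z s, (s <= 3)%R & ball z s (ctr j)]] <= (3 * c)%:E * v (block j))%E.
Proof.
set E := [set x | _].
have [[x [_ [z [s [bad s3 Bc]]]]]|nE] := pselect (exists x, E x); last first.
  rewrite (_ : E = set0); first by rewrite measure0 mule_ge0 ?nu_ge0// lee_fin mulr_ge0// ltW.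
  by apply/seteqP; split => // x Ex; apply: nE; exists x.
have El : E `<=` light n j by move=> y [].
have [s0 _ _] := bad.
apply: (le_trans (le_mu _ El)); apply: (le_trans (mu_light mu1 tau0 j)).
rewrite EFinM EFinM -muleA lee_pmul2l ?lte_fin// -(mu_ctr mu1).
have zj : z.1 = j by rewrite -(mball_block s3 Bc).
have Bj : ball z s `<=` block j by rewrite -zj; exact: mball_block.
apply: le_trans (c_le Bj); apply: le_trans (bad_mu bad).
by apply: le_mu => _ ->; exact: (mball_sub_dilate k1 s0 Bc).
Qed.

(** Either the dilate of some bad ball covers all leaves and pays for the whole heavy part, or each
    bad leaf is the only heavy point of its ball and [mu_bad_leaf] applies. In the sum over at most
    [n j] leaves, the [nu] of the leaves add up to at most that of the block, and the block terms
    produce the quantity bounded by [C]. *)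
Lemma mu_level_heavy j : (mu [set x | heavy n j x /\ exists z s,
  [/\ bad_at x z s, (s <= 3)%R & ball z s (ctr j)]] <= ((1 + C) * c)%:E * v (block j))%E.
Proof.
set E := [set x | _].
have block_ge : (c%:E * v (block j) <= ((1 + C) * c)%:E * v (block j))%E.
  by rewrite lee_wpmul2r ?nu_ge0// lee_fin ler_peMl ?(ltW c_gt0)// lerDl.
have [[x [z [s [bad s3 Bc all_leaves]]]]|nall] := pselect (exists x z s,
    [/\ bad_at x z s, s <= 3, ball z s (ctr j) &
        forall k, ball z (kappa * s) (leaf j k)]).
  apply: le_trans block_ge.
  have zj : z.1 = j by rewrite -(mball_block s3 Bc).
  have Bj : ball z s `<=` block j by rewrite -zj; exact: mball_block.
  apply: le_trans (c_le Bj); apply: le_trans (bad_mu bad).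
  by apply: le_mu => y [[i _ ->] _].
have Eon x : E x -> on j /\ exists2 i, (i < n j)%N & x = leaf j i /\
    (mu [set leaf j i] <=
      c%:E * (v [set leaf j i] + ((M j / 3) `^ (1 - p))%:E * v (block j)))%E.
  move=> [[i ij ->] [z [s [bad s3 Bc]]]]; have [s0 az badz] := bad.
  have Bl := adm_ball s0 az.
  case: (adm_leaf s3 az Bc Bl) => [h|[onj only]].
    by exfalso; apply: nall; exists (leaf j i), z, s.
  split=> //; exists i => //; split=> //.
  apply: (mu_bad_leaf mu_fin mu1_gt0 k1 p1 lam0 s0 nu_fin badz mu1) => //.
    exact: bad_dilate bad.
  move=> y yB; have [[k kj yk]|ny] := pselect (heavy n j y); last first.
    have zj : z.1 = j by rewrite -(mball_block s3 Bc).
    by right; split=> //; rewrite -zj; exact: mball_block yB.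
  left; rewrite yk /=; case: (eqVneq k i) => [->//|ki]; exfalso.
  by apply: (only _ ki); rewrite -yk; exact: (mball_sub_dilate k1 s0 yB).
have [[x /Eon[onj _]]|nE] := pselect (exists x, E x); last first.
  rewrite (_ : E = set0).
    by rewrite measure0 mule_ge0 ?nu_ge0// lee_fin mulr_ge0 ?(ltW c_gt0)// addr_ge0.
  by apply/seteqP; split => // x Ex; apply: nE; exists x.
set q := (M j / 3) `^ (1 - p) in Eon.
have q0 : 0 <= q by exact: powR_ge0.
have Ei i : (mu (E `&` [set leaf j i]) <=
    c%:E * v [set leaf j i] + (c * q)%:E * v (block j))%E.
  have [El|nEl] := pselect (E (leaf j i)).
    have [_ [k _ [[<-] h]]] := Eon _ El.
    apply: (le_trans (le_mu _ (@subIsetr _ _ _))); apply: (le_trans h).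
    by rewrite ge0_muleDr ?mule_ge0 ?nu_ge0 ?lee_fin// EFinM muleA.
  rewrite (_ : E `&` [set leaf j i] = set0).
    by rewrite measure0 adde_ge0// mule_ge0 ?nu_ge0// lee_fin ?mulr_ge0// ltW.
  by apply/seteqP; split => // y [Ey yx]; apply: nEl; rewrite -yx.
have EU : E `<=` \big[setU/set0]_(i < n j) (E `&` [set leaf j i]).
  rewrite -(bigcup_mkord (n j) (fun i => E `&` [set leaf j i])) => y Ey.
  by have [_ [i ij [yi _]]] := Eon _ Ey; exists i => //; split => //; rewrite yi.
apply: (le_trans (@content_subadditive _ _ _ mu E
  (fun i => E `&` [set leaf j i]) (n j) _ _ EU)) => //.
apply: (@le_trans _ _ (\sum_(i < n j) (c%:E * v [set leaf j i] + (c * q)%:E * v (block j)))%E).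
  by apply: lee_sum => i _; exact: Ei.
rewrite big_split/= mulrDl mul1r EFinD ge0_muleDl ?lee_fin ?(mulr_ge0 C0) ?(ltW c_gt0)//.
apply: leeD; last first.
  rewrite -(fineK (nu_fin_num nu_fin (block j))) -!EFinM sumEFin sumr_const card_ord.
  rewrite lee_fin -[leLHS]mulr_natl mulrA ler_wpM2r ?fine_ge0 ?nu_ge0//.
  by rewrite mulrCA mulrC ler_wpM2r ?(ltW c_gt0)//; exact: onC.
rewrite -ge0_sume_distrr; last by move=> i _; exact: nu_ge0.
rewrite lee_pmul2l ?lte_fin//.
have := @nneseries_lim_ge R (fun i => v [set leaf j i]) xpredT 0 (n j).
rewrite big_mkord => /(_ (fun _ _ _ => nu_ge0 _ _ _ _)) h; apply: (le_trans h).
rewrite -nu_bigcup; first by apply: le_nu => y [i _ ->].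
apply/trivIsetP => i k _ _ ik; apply/seteqP; split => // y [/= -> []] /eqP.
by rewrite (negbTE ik).
Qed.

(** A bad ball of radius above 3 is the whole space and settles everything. Otherwise bad balls stay
    inside blocks, and the three partial estimates add up to [2 + 3 + (1 + C)]. *)
Lemma mu_level :
  (mu [set x | (lam%:E < T f x)%E] <= ((6 + C) * c)%:E * v setT)%E.
Proof.
set E := [set x | _].
have Ebad x : E x -> exists z s, bad_at x z s by move=> /opP.
have K0 : 0 <= (6 + C) * c by rewrite mulr_ge0 ?(ltW c_gt0)// addr_ge0.
have [[x [z [s [bad s3]]]]|small] := pselect (exists x z s, bad_at x z s /\ 3 < s).
  have [s0 _ _] := bad.
  apply: (@le_trans _ _ (c%:E * v setT)%E); last first.
    rewrite lee_wpmul2r ?nu_ge0// lee_fin ler_peMl ?(ltW c_gt0)//.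
    by move: C0; lra.
  apply: (@le_trans _ _ (mu setT)); first exact: le_mu.
  have ks3 : 3 < kappa * s by apply: (lt_le_trans s3); rewrite ler_peMl// ltW.
  by have := bad_mu bad; rewrite (mball_setT t e13 z ks3) (mball_setT t e13 z s3).
have Ej j : (mu (E `&` block j) <= ((6 + C) * c)%:E * v (block j))%E.
  have h1 := mu_level_offcenter j; have h2 := mu_level_light j.
  have h3 := mu_level_heavy j; move: h1 h2 h3.
  set E1 := [set x | _]; set E2 := [set x | _]; set E3 := [set x | _] => h1 h2 h3.
  have h : E `&` block j `<=` E1 `|` (E2 `|` E3).
    move=> x [/Ebad[z [s bad]] xj].
    have s3 : s <= 3.
      by rewrite leNgt; apply/negP => s3; apply: small; exists x, z, s.
    have [Bc|nBc] := pselect (ball z s (ctr j)); last first.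
      by left; split=> //; exists z, s.
    have [hx|lx] := pselect (heavy n j x); right; [right|left].
      by split=> //; exists z, s.
    by split=> //; exists z, s.
  apply: (le_trans (le_mu _ h)); apply: (le_trans (muU _ _ _)).
  have -> : (6 + C) * c = 2 * c + (3 * c + (1 + C) * c) by ring.
  rewrite EFinD ge0_muleDl ?lee_fin ?mulr_ge0 ?(ltW c_gt0)//; last first.
    by rewrite addr_ge0// mulr_ge0 ?(ltW c_gt0)// addr_ge0.
  apply: leeD => //; apply: (le_trans (muU _ _ _)).
  rewrite EFinD ge0_muleDl ?lee_fin ?mulr_ge0 ?(ltW c_gt0)// ?addr_ge0//.
  exact: leeD.
have EU : E `<=` \bigcup_j (E `&` block j) by move=> x Ex; exists x.1.
apply: (le_trans (measure_sigma_subadditive _ _ _ EU)) => //.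
apply: (le_trans (lee_nneseries _ (fun j _ => Ej j))) => //.
rewrite nneseriesZl//; last by move=> j _; exact: nu_ge0.
rewrite lee_wpmul2l// -nu_bigcup; first exact: le_nu.
apply/trivIsetP => j k _ _ /eqP jk; apply/seteqP; split => // x [xj xk].
by apply: jk; rewrite -(xj : x.1 = j) -(xk : x.1 = k).
Qed.

End Level.

Lemma Lnorm_nu (p : R) (f : pt -> R) :
  Lnorm mu p%:E (fun x => (f x)%:E) = ((nu mu f p setT) `^ (p^-1))%E.
Proof.
by rewrite unlock /Lnorm /nu; congr (_ `^ _)%E.
Qed.

Lemma outer_mu_le (A : set pt) : (outer_mu mu A <= mu A)%E.
Proof. by apply: ereal_inf_lbound; exists A => //; split. Qed.

Lemma outer_mu_ge (A : set pt) : (mu A <= outer_mu mu A)%E.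
Proof. by apply: le_ereal_inf_tmp => _ [B [_ AB] <-]; exact: le_mu. Qed.

Lemma weak_type_of_bound (p C : R) : 1 <= p -> 0 <= C ->
  (forall j, on j -> (n j)%:R * (M j / 3) `^ (1 - p) <= C) ->
  weak_type mu T p%:E.
Proof.
(* The [p]-th root of the constant in [mu_level]; the 3 comes from the level [lam / 3]. *)
move=> p1 C0 onC; exists (3 * (6 + C) `^ p^-1) => f _; rewrite Lnorm_nu => Nfin lam lam0.
have p0 : 0 < p by exact: lt_le_trans p1.
have nu_fin : (nu mu f p setT < +oo)%E.
  rewrite ltey; apply/eqP => vy; move: Nfin.
  by rewrite vy poweRyr ?ltxx// gt_eqF// invr_gt0.
have := mu_level p1 lam0 C0 onC nu_fin.
set E := [set x | _] => h.
have Efin : mu E \is a fin_num by exact: mu_fin_num.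
have oE : outer_mu mu E = (fine (mu E))%:E.
  by rewrite fineK//; apply/eqP; rewrite eq_le outer_mu_le outer_mu_ge.
move: h; rewrite oE -{1}(fineK Efin) -(fineK (nu_fin_num nu_fin setT)).
rewrite -EFinM lee_fin !poweR_EFin -!EFinM lee_fin.
have m0 : 0 <= fine (mu E) by rewrite fine_ge0.
have v0 : 0 <= fine (nu mu f p setT) by rewrite fine_ge0// nu_ge0.
have a0 : 0 < lam / 3 by rewrite divr_gt0.
have c0 : 0 < ((lam / 3) `^ p)^-1 by rewrite invr_gt0 powR_gt0.
have K0 : 0 <= 6 + C by rewrite addr_ge0.
move: (fine (mu E)) (fine (nu mu f p setT)) m0 v0 => m v m0 v0 h.
apply: (@le_trans _ _ (lam * ((6 + C) / (lam / 3) `^ p * v) `^ p^-1)).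
  rewrite ler_pM2l//; apply: ge0_ler_powR; rewrite ?nnegrE ?invr_ge0 ?(ltW p0)//.
  by rewrite mulr_ge0// mulr_ge0// ltW.
rewrite powRM// ?mulr_ge0 ?(ltW c0)// powRM ?(ltW c0)//.
rewrite -powRN -powRrM mulNr mulfV ?gt_eqF// powR_inv1 ?(ltW a0)//.
rewrite le_eqVlt; apply/orP; left; apply/eqP; field.
by rewrite gt_eqF.
Qed.

Hypothesis adm_self : forall x, adm x x 1.

(** Every point is an atom, so the essential supremum bounds [f] everywhere; dividing by the mass of
    a larger ball only decreases an average, and the constant 1 works. *)
Lemma weak_type_infty : weak_type mu T +oo%E.
Proof.
exists 1 => f _; rewrite mul1e unlock /Lnorm.
have muT0 : (0 < mu setT)%E.
  by apply: (lt_le_trans (mu1_gt0 (ctr 0))); exact: le_mu.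
rewrite muT0; set L := ess_sup mu _ => Lfin; rewrite -/L.
have L0 : (0 <= L)%E by apply: ess_sup_gee => //; apply: nearW => x; exact: abse_ge0.
have fL x : (`|f x|%:E <= L)%E.
  have [N [_ N0 sub]] := ess_sup_ge mu (abse \o (fun x => (f x)%:E)).
  rewrite leNgt; apply/negP => Lf; have := mu1_gt0 x; rewrite ltNge => /negP; apply.
  rewrite -N0; apply: le_mu => _ ->; apply: sub => /=.
  by apply/negP; rewrite -ltNge.
(* Without any admissible ball [T f x] would be [-oo]; [adm_self] prevents this, so the absolute
   value in the norm is harmless. *)
have Tge0 x : (0 <= T f x)%E.
  rewrite leNgt; apply/negP => Tx; have : (T f x < T f x)%E; last by rewrite ltxx.
  apply/opP; exists x, 1; split=> //; apply: (lt_le_trans Tx).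
  by apply: mule_ge0; [exact: integral_ge0|rewrite lee_fin invr_ge0 fine_ge0].
apply/ess_supP; apply: nearW => x /=; rewrite gee0_abs//.
rewrite leNgt; apply/negP => /opP[z [s [s0 az]]].
have Lf : L \is a fin_num by rewrite ge0_fin_numE.
rewrite -(fineK Lf) => bad; have := bad_ball_lt mu_fin mu1_gt0 k1 s0 bad.
rewrite fineK// ltNge => /negP; apply.
apply: (@le_trans _ _ (L * mu (ball z s))%E).
  by rewrite -integral_cst//; apply: ge0_le_integral.
by rewrite lee_wpmul2l//; apply: le_mu; exact: mball_sub_dilate.
Qed.

End UpperBound.

(** * Necessity: testing on the indicator of a center *)

Section LowerBound.
Context {R : realType}.
Variables (t : nat -> bool) (e : nat -> R) (n : nat -> nat) (M tau : nat -> R).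
Variables (mu : {measure set pt -> \bar R}) (kappa : R).
Hypothesis mu1 : forall x, mu [set x] = (mass n M tau x)%:E.
Hypothesis tau0 : forall j, 0 < tau j.
Hypothesis M1 : forall j, 1 <= M j.
Hypothesis mu_fin : (mu setT < +oo)%E.
Hypothesis k1 : 1 <= kappa.

Local Notation ball z s := (mball (rho t e) z s).

Let M0 j : 0 < M j.
Proof. exact: lt_le_trans (M1 j). Qed.

(** The dilated ball weighs at most [tau j * (M j + 3)], hence at most [4 * tau j * M j] as
    [1 <= M j]; the 8 leaves room for a strict inequality. *)
Lemma ball_avg_ctr j i z s : (i < n j)%N -> 0 < s -> ball z s (ctr j) ->
  ball z (kappa * s) `<=` [set leaf j i] `|` light n j ->
  (((8 * M j)^-1)%:E < ball_avg (rho t e) mu kappa \1_[set ctr j] z s)%E.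
Proof.
move=> ij s0 Bc kB; rewrite /ball_avg.
have -> : (\int[mu]_(x in ball z s) `|\1_[set ctr j] x|%:E)%E = (tau j)%:E.
  transitivity (mu ([set ctr j] `&` ball z s)).
    rewrite -integral_indic//; apply: eq_integral => x _.
    by rewrite ger0_norm.
  by rewrite -(mu_ctr mu1); congr (mu _); apply/seteqP; split => [x []//|x ->].
have kBc : ball z (kappa * s) (ctr j) by exact: (mball_sub_dilate k1 s0 Bc).
have kBfin : mu (ball z (kappa * s)) \is a fin_num by exact: mu_fin_num.
have kBle : fine (mu (ball z (kappa * s))) <= 4 * (tau j * M j).
  rewrite -lee_fin fineK//; apply: (le_trans (le_mu _ kB)).
  apply: (le_trans (muU _ _ _)); rewrite (mu_leaf mu1 ij).
  apply: (le_trans (leeD2l _ (mu_light mu1 tau0 j))); rewrite -EFinD lee_fin.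
  suff : tau j <= tau j * M j by lra.
  by rewrite ler_pMr.
have kBgt : 0 < fine (mu (ball z (kappa * s))).
  have : (mu [set ctr j] <= mu (ball z (kappa * s)))%E by apply: le_mu => _ ->.
  by rewrite (mu_ctr mu1) -{1}(fineK kBfin) lee_fin; exact: lt_le_trans.
rewrite -EFinM lte_fin ltr_pdivlMr// ltr_pdivrMl ?mulr_gt0//.
apply: (le_lt_trans kBle).
have := mulr_gt0 (tau0 j) (M0 j); lra.
Qed.

Variables (adm : pt -> pt -> R -> Prop) (T : (pt -> R) -> pt -> \bar R).
Variable on : nat -> Prop.
Hypothesis opP : forall f x l, (l < T f x)%E <->
  exists z s, [/\ 0 < s, adm x z s & (l < ball_avg (rho t e) mu kappa f z s)%E].
Hypothesis adm_on : forall j i, on j -> exists z s,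
  [/\ 0 < s, adm (leaf j i) z s, ball z s (ctr j) &
      ball z (kappa * s) `<=` [set leaf j i] `|` light n j].

(** At height [(8 * M j)^-1] the level set contains all heavy leaves, of mass [n j * tau j * M j],
    while the [p]-th power of the norm is [tau j]; the factor [tau j] cancels. *)
Lemma bound_of_weak_type (p : R) : 1 <= p -> weak_type mu T p%:E ->
  exists C, forall j, on j -> (n j)%:R * M j `^ (1 - p) <= C.
Proof.
move=> p1 [C wt]; exists (8 `^ p * `|C| `^ p) => j onj.
have p0 : 0 < p by exact: lt_le_trans p1.
set f : pt -> R := \1_[set ctr j].
have nuf : nu mu f p setT = (tau j)%:E.
  rewrite -(mu_ctr mu1) -[in RHS](setIT [set ctr j]) -integral_indic//.
  apply: eq_integral => x _; rewrite /f indicE.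
  by case: (x \in _); rewrite ?normr1 ?powR1// normr0 powR0// gt_eqF.
have Lf : Lnorm mu p%:E (fun x => (f x)%:E) = (tau j `^ p^-1)%:E.
  by rewrite Lnorm_nu nuf poweR_EFin.
have lam0 : 0 < (8 * M j)^-1 by rewrite invr_gt0 mulr_gt0.
have := wt f (@pt_measurable_fun _ _ _ _); rewrite Lf => /(_ (ltry _) _ lam0).
set E := [set x | _].
have hE : heavy n j `<=` E.
  move=> _ [i ij ->]; apply/opP; have [z [s [s0 az Bc kB]]] := adm_on i onj.
  by exists z, s; split => //; exact: ball_avg_ctr kB.
have oE : outer_mu mu E = (fine (mu E))%:E.
  by rewrite fineK ?mu_fin_num//; apply/eqP; rewrite eq_le outer_mu_le outer_mu_ge.
have Ege : (n j)%:R * (tau j * M j) <= fine (mu E).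
  by rewrite -lee_fin fineK ?mu_fin_num// -(mu_heavy mu1); exact: le_mu.
rewrite oE poweR_EFin -!EFinM lee_fin => h.
have nM0 : 0 <= (n j)%:R * (tau j * M j) by rewrite !mulr_ge0// ltW.
have {}h : (8 * M j)^-1 * ((n j)%:R * (tau j * M j)) `^ p^-1 <= `|C| * tau j `^ p^-1.
  apply: (@le_trans _ _ (C * tau j `^ p^-1)); last first.
    by rewrite ler_wpM2r ?powR_ge0// ler_norm.
  apply: le_trans h; rewrite ler_pM2l//; apply: ge0_ler_powR => //.
  - by rewrite invr_ge0 ltW.
  - by rewrite nnegrE (le_trans nM0).
have {h} : ((8 * M j)^-1 * ((n j)%:R * (tau j * M j)) `^ p^-1) `^ p <=
    (`|C| * tau j `^ p^-1) `^ p.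
  apply: ge0_ler_powR => //; rewrite ?nnegrE ?(ltW p0)//.
  - by rewrite mulr_ge0 ?powR_ge0// ltW.
  - by rewrite mulr_ge0 ?powR_ge0.
rewrite [leLHS]powRM ?powR_ge0 ?(ltW lam0)// [leRHS]powRM ?powR_ge0//.
rewrite -!powRrM mulVf ?gt_eqF// !powRr1 ?(ltW (tau0 j))//.
have -> : (8 * M j)^-1 `^ p = (8 `^ p)^-1 * M j `^ (- p).
  rewrite -powR_inv1 ?mulr_ge0 ?(ltW (M0 j))// -powRrM mulN1r.
  by rewrite powRM ?(ltW (M0 j))// !powRN.
have -> : M j `^ (1 - p) = M j * M j `^ (- p).
  by rewrite powRD ?(gt_eqF (M0 j)) ?implybT// powRr1// ltW.
have := powR_gt0 p (ltr0Sn R 7); move: (8 `^ p) (M j `^ _) (`|C| `^ p) => a b c a0 h.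
have : tau j * (a^-1 * ((n j)%:R * (M j * b))) <= tau j * c by move: h; lra.
by rewrite ler_pM2l// ler_pdivrMl.
Qed.

End LowerBound.

(** * Parameters realizing a given nonincreasing function *)

Section Profile.
Context {R : realType}.
Variables (g : R -> \bar R) (K : R).
Hypothesis K1 : 1 <= K.
Hypothesis g_ge1 : forall k, 1 <= k <= K -> (1 <= g k)%E.
Hypothesis g_anti : forall a b, 1 <= a -> a <= b -> b <= K -> (g b <= g a)%E.

Definition below (r : R) : set R := [set k | 1 <= k < K /\ (g k < r%:E)%E].

(** All pairs are coded, so each threshold recurs with arbitrarily large denominators; the successor
    keeps [level j] positive. *)
Let level (j : nat) : nat := (odflt (0, 0)%N (unpickle j)).1.+1.
Let step (j : nat) : nat := (odflt (0, 0)%N (unpickle j)).2.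
Definition threshold (j : nat) : R := 1 + (step j)%:R / (level j)%:R.

Lemma below_inf_lb r k : below r k -> inf (below r) <= k.
Proof. by apply: ge_inf; exists 1 => x [/andP[]]. Qed.

Lemma below_adherent r k eps : 0 < eps -> below r k ->
  exists2 k', below r k' & k' < inf (below r) + eps.
Proof.
move=> eps0 bk; apply: inf_adherent => //; split; first by exists k.
by exists 1 => x [/andP[]].
Qed.

(* [V] will be the infima of the finitely many earlier sets [below r']: they force
   [x] back to the edge of such a set as soon as it is not contained in ours, which
   [eps] alone cannot do for infinitely many thresholds at once. *)
Lemma cut_exists r eps (V : seq R) : 0 < eps -> exists x, [/\ 1 <= x <= K,
  forall k, 1 <= k < K -> (r%:E <= g k)%E -> k < x,
  forall k, k \in V -> below r k -> x <= k &
  forall k, below r k -> x <= k + eps].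
Proof.
move=> eps0; elim: V => [|v V [x [x1K xS xV xe]]].
  have [[k0 bk0]|nb] := pselect (exists k, below r k); last first.
    exists K; split => //; first by rewrite lexx K1.
    - by move=> k /andP[].
    - by move=> k bk; exfalso; apply: nb; exists k.
  have [x [/andP[x1 xK] gx] xlt] := below_adherent eps0 bk0.
  exists x; split => //; first by rewrite x1 ltW.
  - move=> k /andP[k1 kK] rk; rewrite ltNge; apply/negP => xk.
    have := le_lt_trans (le_trans rk (g_anti x1 xk (ltW kK))) gx.
    by rewrite ltxx.
  - move=> k bk; apply: (le_trans (ltW xlt)); rewrite lerD2r.
    exact: below_inf_lb.
have [bv|nbv] := pselect (below r v); last first.
  exists x; split => // k; rewrite inE => /orP[/eqP ->|]; [by []|exact: xV].
have [/andP[v1 vK] gv] := bv.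
exists (Num.min x v); split.
- case/andP: x1K => x1 xK; rewrite le_min x1 v1 /=.
  by rewrite ge_min xK.
- move=> k kK rk; rewrite lt_min xS//=; rewrite ltNge; apply/negP => vk.
  case/andP: kK => k1 kK.
  have := le_lt_trans (le_trans rk (g_anti v1 vk (ltW kK))) gv.
  by rewrite ltxx.
- move=> k; rewrite inE ge_min => /orP[/eqP ->|kV bk]; first by rewrite lexx orbT.
  by rewrite xV.
- by move=> k bk; rewrite ge_min xe.
Qed.

(** For the last property, let [v] be the infimum of [below (threshold i)]. If it is attained, it is
    among the infima imposed on every later cut, so [x j <= v]. Otherwise some [k'] of the set is
    strictly less than [k], and the tolerance [j.+1%:R^-1] eventually fits between them. *)
Lemma cuts_exist : exists x : nat -> R, [/\ forall j, 1 <= x j <= K,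
  forall j k, 1 <= k < K -> ((threshold j)%:E <= g k)%E -> k < x j &
  forall i k, below (threshold i) k ->
    exists J, forall j, (J <= j)%N -> threshold i <= threshold j -> x j <= k].
Proof.
have H j : exists x, [/\ 1 <= x <= K,
    forall k, 1 <= k < K -> ((threshold j)%:E <= g k)%E -> k < x,
    forall k, k \in [seq inf (below (threshold i)) | i <- iota 0 j] ->
      below (threshold j) k -> x <= k &
    forall k, below (threshold j) k -> x <= k + j.+1%:R^-1].
  by apply: cut_exists; rewrite invr_gt0.
have [x xP] := choice H; exists x; split => [j|j|i k bk]; [by case: (xP j)..|].
have below_le r r' k' : r <= r' -> below r k' -> below r' k'.
  by move=> rr' [k1K gk]; split => //; apply: (lt_le_trans gk); rewrite lee_fin.
have [binf|nbinf] := pselect (below (threshold i) (inf (below (threshold i)))).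
  exists i.+1 => j ij tij; have [_ _ xV _] := xP j.
  apply: le_trans (below_inf_lb bk); apply: xV; last exact: below_le binf.
  by apply/mapP; exists i => //; rewrite mem_iota.
have klt : inf (below (threshold i)) < k.
  rewrite lt_neqAle below_inf_lb// andbT; apply/eqP => E.
  by apply: nbinf; rewrite E.
have [||k' bk' k'lt] := @below_adherent (threshold i) k (k - inf (below (threshold i))).
- by rewrite subr_gt0.
- by [].
rewrite addrC subrK in k'lt.
have [J hJ] := ltr_add_invr k'lt; exists J => j Jj tij.
have [_ _ _ xe] := xP j.
apply: (le_trans (xe _ (below_le _ _ _ tij bk'))).
apply: le_trans (ltW hJ); rewrite lerD2l lef_pV2 ?posrE//.
by rewrite ler_nat.
Qed.

Let leaves (j : nat) : nat := (2 ^ (level j * (step j + 2)))%N.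
Let weight (j : nat) : R := 2 ^+ (level j * level j).

Lemma leaves_weight j p : (leaves j)%:R * weight j `^ (1 - p) =
  2 `^ (2 * (level j)%:R + (level j)%:R ^+ 2 * (threshold j - p)).
Proof.
have N0 : (level j)%:R != 0 :> R by rewrite pnatr_eq0.
rewrite /leaves /weight natrX -!powR_mulrn// -powRrM -powRD; last first.
  by rewrite (pnatr_eq0 _ 2) implybT.
congr (_ `^ _); rewrite /threshold !natrM natrD powR_mulrn//; field.
by rewrite N0.
Qed.

Lemma threshold_between a b : 1 <= a -> a < b ->
  exists j, a < threshold j < b.
Proof.
move=> a1 ab; have [m hm] := ltr_add_invr ab.
have N0 : 0 < m.+1%:R :> R by [].
have /truncn_itv/andP[i1 i2] : 0 <= (a - 1) * m.+1%:R.
  by rewrite mulr_ge0// subr_ge0.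
(* The successor of the truncation gives the first grid point strictly above [a]. *)
exists (pickle (m, (Num.truncn ((a - 1) * m.+1%:R)).+1)).
rewrite /threshold /level /step pickleK /=; apply/andP; split.
  by rewrite -ltrBlDl ltr_pdivlMr.
apply: le_lt_trans hm; rewrite -lerBrDl ler_pdivrMr// -[leLHS]natr1.
suff -> : (a + m.+1%:R^-1 - 1) * m.+1%:R = (a - 1) * m.+1%:R + 1 by rewrite lerD2r.
by move: N0; move: (m.+1%:R) => N N0; field; rewrite gt_eqF.
Qed.

(** With the denominator prescribed, the last grid point up to [p] makes the exponent in
    [leaves_weight] at least [m.+1]. *)
Lemma threshold_near p m : 1 <= p ->
  exists j, [/\ level j = m.+1, threshold j <= p & p < threshold j + m.+1%:R^-1].
Proof.
move=> p1; have N0 : 0 < m.+1%:R :> R by [].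
have /truncn_itv/andP[i1 i2] : 0 <= (p - 1) * m.+1%:R.
  by rewrite mulr_ge0// subr_ge0.
exists (pickle (m, Num.truncn ((p - 1) * m.+1%:R))).
rewrite /threshold /level /step pickleK /=; split => //.
  by rewrite -lerBrDl ler_pdivrMr.
rewrite -addrA -ltrBlDl -[X in _ < _ + X]mul1r -mulrDl ltr_pdivlMr//.
by rewrite natr1.
Qed.

(** If [p <= g k], the thresholds of [threshold_near] have cuts beyond [k] and give unbounded
    values. If [g k < p], fix a threshold strictly between: all but finitely many [j] with [k < x j]
    have a smaller threshold, which bounds the exponent. *)
Lemma profile : exists (x : nat -> R) (n : nat -> nat) (M : nat -> R),
  [/\ forall j, 1 <= x j <= K, forall j, 1 <= M j &
  forall k, 1 <= k < K -> forall p, 1 <= p ->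
    ((exists C, forall j, k < x j -> (n j)%:R * M j `^ (1 - p) <= C) <->
     (g k < p%:E)%E)].
Proof.
have [x [x1K xS xB]] := cuts_exist.
exists x, leaves, weight; split => // [j|k k1K p p1].
  by rewrite /weight exprn_ege1// ler1n.
split=> [[C hC]|gp].
  rewrite ltNge; apply/negP => pg.
  pose m := Num.truncn `|C|.
  have [j [lj tj pj]] := threshold_near m p1.
  have kx : k < x j.
    by apply: xS => //; apply: le_trans pg; rewrite lee_fin.
  have := hC j kx; apply/negP; rewrite -ltNge leaves_weight lj.
  have /truncn_itv/andP[_ mC] := normr_ge0 C.
  apply: (le_lt_trans (ler_norm C)); apply: (lt_le_trans mC).
  apply: (@le_trans _ _ (2 `^ m.+1%:R)).
    rewrite powR_mulrn// -natrX ler_nat ltnW//; exact: ltn_expl.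
  apply: ler_powR; first by rewrite ler1n.
  have N0 : 0 < m.+1%:R :> R by [].
  move: N0 pj; rewrite -/m; move: (m.+1%:R) => N N0 pj.
  have : N * (p - threshold j) <= 1.
    by rewrite mulrC -ler_pdivlMr// div1r; lra.
  rewrite expr2 => h; have : N * (N * (p - threshold j)) <= N * 1 by rewrite ler_pM2l.
  lra.
have gk1 : (1 <= g k)%E by apply: g_ge1; case/andP: k1K => -> /ltW.
have [a ga] : exists a, g k = a%:E.
  by move: gp gk1; case: (g k) => [a| |] //; exists a.
rewrite ga lte_fin in gp; rewrite ga lee_fin in gk1.
have [i /andP[ai ip]] := threshold_between gk1 gp.
have bk : below (threshold i) k by split => //; rewrite ga lte_fin.
have [J hJ] := xB _ _ bk.
pose phi j := (leaves j)%:R * weight j `^ (1 - p).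
have phi0 j : 0 <= phi j by rewrite mulr_ge0 ?powR_ge0.
(* The first term bounds the values at all late [j], whatever the level; the sum covers the finitely
   many [j < J]. *)
exists (2 `^ (p - threshold i)^-1 + \sum_(j < J) phi j) => j kx.
have [jJ|Jj] := ltnP j J.
  rewrite ler_wpDl ?powR_ge0// (bigD1 (Ordinal jJ))//= lerDl.
  by apply: sumr_ge0.
rewrite ler_wpDr ?sumr_ge0// leaves_weight; apply: ler_powR; first by rewrite ler1n.
have tji : threshold j < threshold i.
  rewrite ltNge; apply/negP => h; have := hJ _ Jj h.
  by rewrite leNgt kx.
have d0 : 0 < p - threshold i by rewrite subr_gt0.
rewrite -[leRHS]mul1r ler_pdivlMr//.
move: (level j)%:R (ler0n R (level j)) => N N0.
have h1 : N ^+ 2 * (threshold j - p) <= - (N ^+ 2 * (p - threshold i)).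
  by rewrite -mulrN ler_wpM2l ?exprn_ge0//; lra.
(* With [d = p - threshold i], this square gives [2 * N - N ^+ 2 * d <= d^-1]. *)
have : 0 <= (1 - N * (p - threshold i)) ^+ 2 by exact: sqr_ge0.
move: (p - threshold i) d0 h1 => d d0 h1 h2.
apply: (@le_trans _ _ ((2 * N - N ^+ 2 * d) * d)); last by lra.
by rewrite ler_pM2r// lerD2l.
Qed.

End Profile.

(** * The centered and the non-centered operator on the block space *)

Section Operators.
Context {R : realType}.
Variables (t : nat -> bool) (e : nat -> R) (n : nat -> nat) (M tau : nat -> R).
Variables (mu : {measure set pt -> \bar R}) (kappa : R).
Hypothesis e13 : forall j, 1 <= e j <= 3.
Hypothesis te2 : forall j, t j -> e j <= 2.
Hypothesis mu1 : forall x, mu [set x] = (mass n M tau x)%:E.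
Hypothesis tau0 : forall j, 0 < tau j.
Hypothesis M1 : forall j, 1 <= M j.
Hypothesis mu_fin : (mu setT < +oo)%E.
Hypothesis k1 : 1 <= kappa.

Local Notation ball z s := (mball (rho t e) z s).

Lemma lt_McP f x l : (l < Mc (rho t e) mu kappa f x)%E <->
  exists z s, [/\ 0 < s, z = x & (l < ball_avg (rho t e) mu kappa f z s)%E].
Proof.
split=> [/ereal_sup_gt[_ [s s0 <-] h]|[z [s [s0 -> h]]]]; first by exists x, s.
by apply: (lt_le_trans h); apply: ereal_sup_ubound; exists s.
Qed.

Lemma lt_MuP f x l : (l < Mu (rho t e) mu kappa f x)%E <->
  exists z s, [/\ 0 < s, ball z s x & (l < ball_avg (rho t e) mu kappa f z s)%E].
Proof.
split=> [/ereal_sup_gt[_ [[z s] [s0 zx] <-] h]|[z [s [s0 zx h]]]].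
  by exists z, s.
by apply: (lt_le_trans h); apply: ereal_sup_ubound; exists (z, s).
Qed.

Lemma weak_type_bound_iff (adm : pt -> pt -> R -> Prop)
    (T : (pt -> R) -> pt -> \bar R) (on : nat -> Prop) :
  (forall f x l, (l < T f x)%E <->
    exists z s, [/\ 0 < s, adm x z s & (l < ball_avg (rho t e) mu kappa f z s)%E]) ->
  (forall x z s, 0 < s -> adm x z s -> ball z s x) ->
  (forall j i z s, s <= 3 ->
    adm (leaf j i) z s -> ball z s (ctr j) -> ball z s (leaf j i) ->
    (forall k, ball z (kappa * s) (leaf j k)) \/
    (on j /\ forall k, k != i -> ~ ball z (kappa * s) (leaf j k))) ->
  (forall j i, on j -> exists z s,
    [/\ 0 < s, adm (leaf j i) z s, ball z s (ctr j) &
        ball z (kappa * s) `<=` [set leaf j i] `|` light n j]) ->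
  forall p, 1 <= p -> weak_type mu T p%:E <->
    exists C, forall j, on j -> (n j)%:R * M j `^ (1 - p) <= C.
Proof.
have M0 j : 0 < M j by exact: lt_le_trans (M1 j).
move=> opP adm_ball adm_leaf adm_on p p1; split.
  exact: (bound_of_weak_type mu1 tau0 M1 mu_fin k1 opP adm_on p1).
move=> [C hC].
(* The extra factor passes from [M j / 3] to [M j]. *)
apply: (weak_type_of_bound e13 mu1 tau0 M0 mu_fin k1 opP adm_ball adm_leaf
  (C := `|C| * 3^-1 `^ (1 - p)) p1).
  by rewrite mulr_ge0// powR_ge0.
move=> j onj; rewrite powRM ?(ltW (M0 j))// mulrA ler_wpM2r ?powR_ge0//.
exact: le_trans (hC j onj) (ler_norm C).
Qed.

Lemma lt1_div j : kappa < e j -> 1 < e j / kappa.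
Proof. by move=> ke; rewrite ltr_pdivlMr ?mul1r// (lt_le_trans _ k1). Qed.

Lemma Mc_weak_type p : 1 <= p -> weak_type mu (Mc (rho t e) mu kappa) p%:E <->
  exists C, forall j, t j /\ kappa < e j -> (n j)%:R * M j `^ (1 - p) <= C.
Proof.
have kappa0 : 0 < kappa by exact: lt_le_trans k1.
apply: (weak_type_bound_iff lt_McP) => [x z s s0 ->|j i z s s3 zE Bc Bl|j i [tj ke]].
- exact: mball_center.
- have [h|[ke tj nk]] := mball_leaves e13 te2 k1 s3 Bc Bl; first by left.
  by right; split=> //; split=> //; exact: tj.
(* The radius exceeds 1 and so reaches the center; the dilated radius is exactly [e j], the distance
   of the other leaves, which strict balls leave out. *)
- have s1 := lt1_div ke; exists (leaf j i), (e j / kappa).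
  rewrite (mulrC kappa) divfK ?gt_eqF//; split => //.
  + exact: lt_trans s1.
  + by rewrite /mball /= rho_block /= tj.
  + exact: mball_leaf_sub.
Qed.

Lemma Mu_weak_type p : 1 <= p -> weak_type mu (Mu (rho t e) mu kappa) p%:E <->
  exists C, forall j, kappa < e j -> (n j)%:R * M j `^ (1 - p) <= C.
Proof.
have kappa0 : 0 < kappa by exact: lt_le_trans k1.
apply: (weak_type_bound_iff lt_MuP) => [//|j i z s s3 zE Bc Bl|j i ke].
- have [h|[ke tj nk]] := mball_leaves e13 te2 k1 s3 Bc Bl; first by left.
  by right; split.
(* From the stem, its leaf and the center are both at distance 1 and foreign leaves at distance
   [e j], whatever [t j] is. *)
- have s1 := lt1_div ke; exists (stem j i), (e j / kappa).
  rewrite (mulrC kappa) divfK ?gt_eqF//; split => //.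
  + exact: lt_trans s1.
  + by rewrite /mball /= rho_block /= eqxx.
  + by rewrite /mball /= rho_block.
  + exact: mball_stem_sub.
Qed.

Lemma Mc_weak_type_infty : weak_type mu (Mc (rho t e) mu kappa) +oo%E.
Proof.
have M0 j : 0 < M j by exact: lt_le_trans (M1 j).
exact: (weak_type_infty mu1 tau0 M0 mu_fin k1 lt_McP).
Qed.

Lemma Mu_weak_type_infty : weak_type mu (Mu (rho t e) mu kappa) +oo%E.
Proof.
have M0 j : 0 < M j by exact: lt_le_trans (M1 j).
apply: (weak_type_infty mu1 tau0 M0 mu_fin k1 lt_MuP) => x.
exact: mball_center.
Qed.

End Operators.

(** * Assembling two families of blocks into one space *)

Theorem theorem3p3p1 (R : realType) (hc h : R -> \bar R) :
  (forall k, 1 <= k <= 2 -> (1 <= hc k)%E) ->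
  (forall k, 1 <= k <= 3 -> (1 <= h k)%E) ->
  (forall a b, 1 <= a -> a <= b -> b <= 2 -> (hc b <= hc a)%E) ->
  (forall a b, 1 <= a -> a <= b -> b <= 3 -> (h b <= h a)%E) ->
  (forall k, 1 <= k <= 2 -> (hc k <= h k)%E) ->
  hc 2 = 1%E -> h 3 = 1%E ->
  exists (d : measure_display) (X : measurableType d) (rho : X -> X -> R)
         (mu : {measure set X -> \bar R}),
    is_mms rho mu /\
    (forall kappa : R, 1 <= kappa < 2 -> forall p : \bar R, (1 <= p)%E ->
       (weak_type mu (Mc rho mu kappa) p <-> ((hc kappa < p)%E \/ p = +oo%E))) /\
    (forall kappa : R, 1 <= kappa < 3 -> forall p : \bar R, (1 <= p)%E ->
       (weak_type mu (Mu rho mu kappa) p <-> ((h kappa < p)%E \/ p = +oo%E))).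
Proof.
move=> hc1 h1 hcA hA hch _ _.
have [xc [nc [Mcw [xc2 Mc1 profc]]]] := profile (ler1n R 2) hc1 hcA.
have [xu [nu [Muw [xu3 Mu1 profu]]]] := profile (ler1n R 3) h1 hA.
(* Odd blocks realize [hc]; even blocks realize [h] and are never bad for the centered operator. *)
pose t j := odd j.
pose e j := if odd j then xc j./2 else xu j./2.
pose n j := if odd j then nc j./2 else nu j./2.
pose M j := if odd j then Mcw j./2 else Muw j./2.
pose tau j : R := (2 ^ j.+1)%:R^-1 / (3 + (n j)%:R * M j).
have e13 j : 1 <= e j <= 3.
  rewrite /e; case: ifP => _; last exact: xu3.
  by have := xc2 j./2; lra.
have te2 j : t j -> e j <= 2.
  by rewrite /t /e => ->; case/andP: (xc2 j./2).
have M1 j : 1 <= M j by rewrite /M; case: ifP.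
have M0 j : 0 < M j by exact: lt_le_trans (M1 j).
have D0 j : 0 < 3 + (n j)%:R * M j by rewrite ltr_wpDr// mulr_ge0// ltW.
have tau0 j : 0 < tau j by rewrite divr_gt0// invr_gt0 ltr0n expn_gt0.
have [mu mu1] := atomic_measure (fun x => ltW (mass_gt0 n tau0 M0 x)).
have mu_fin : (mu setT < +oo)%E.
  apply: (@le_lt_trans _ _ 1%E); last exact: ltry.
  apply: (mu_setT_le1 mu1 tau0) => j.
  by rewrite /tau mulfVK ?gt_eqF// div1r.
exists _, pt, (rho t e), mu; split; last split.
- split; [by exists (ctr 0)|exact: rho_metric|exact: rho_measurable_open|].
  move=> x s s0; split; last by apply: le_lt_trans mu_fin; exact: le_mu.
  apply: (lt_le_trans (mu1_gt0 mu1 tau0 M0 x)).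
  by apply: le_mu => _ ->; exact: mball_center.
- move=> kappa k12; have /andP[k1 k2] := k12.
  case=> [p| |] p1; last (by []); last first.
    by split=> _; [right|exact: (Mc_weak_type_infty t e mu1 tau0 M1 mu_fin k1)].
  rewrite lee_fin in p1.
  apply: (iff_trans (Mc_weak_type e13 te2 mu1 tau0 M1 mu_fin k1 p1)).
  apply: (@iff_trans _ (hc kappa < p%:E)%E); last by split=> [|[]//]; left.
  apply: iff_trans (profc _ k12 _ p1); split=> -[C hC]; exists C => j.
    have := hC j.*2.+1; rewrite /t /e /n /M /= odd_double /= uphalf_double.
    by move=> hj kj; apply: hj.
  by rewrite /t /e /n /M => -[->]; exact: hC.
- move=> kappa k13; have /andP[k1 k3] := k13.
  case=> [p| |] p1; last (by []); last first.
    by split=> _; [right|exact: (Mu_weak_type_infty t e mu1 tau0 M1 mu_fin k1)].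
  rewrite lee_fin in p1.
  apply: (iff_trans (Mu_weak_type e13 te2 mu1 tau0 M1 mu_fin k1 p1)).
  apply: (@iff_trans _ (h kappa < p%:E)%E); last by split=> [|[]//]; left.
  apply: iff_trans (profu _ k13 _ p1); split=> -[C hC].
    exists C => j; have := hC j.*2; rewrite /e /n /M odd_double doubleK.
    by apply.
  have hp : (h kappa < p%:E)%E by apply/(profu _ k13 _ p1); exists C.
  (* Odd blocks also affect the non-centered operator: for [kappa < 2] they are controlled because
     [hc kappa <= h kappa], and for larger [kappa] none of their cuts exceeds [kappa]. *)
  have [C' hC'] : exists C', forall j, kappa < xc j ->
      (nc j)%:R * Mcw j `^ (1 - p) <= C'.
    have [k2|k2] := ltP kappa 2; last first.
      exists 0 => j kj; have /andP[_ xj] := xc2 j.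
      by have := lt_le_trans kj (le_trans xj k2); rewrite ltxx.
    apply/(profc kappa) => //; first by rewrite k1.
    by apply: le_lt_trans hp; apply: hch; rewrite k1 ltW.
  exists (Num.max C C') => j; rewrite /e /n /M le_max.
  by case: ifP => _ kj; rewrite ?hC ?hC'// orbT.
Qed.
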